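(* Let $f:\{0,1\}^k\to\{0,1\}^n$ be a deterministic (not necessarily efficiently computable) function and let $U_k$ be uniform on $\{0,1\}^k$. Then for every $\epsilon>0$, $$\mathrm{H}^{\mathrm{HILL}}_{\tilde{O}(2^k\epsilon^2),\epsilon}(f(U_k))\le k+1.$$ More generally, for any random variable $X$ over $\{0,1\}^n$ whose support has size at most $2^k$, $$\mathrm{H}^{\mathrm{HILL}}_{\tilde{O}(2^k\epsilon^2),\epsilon}(X)\le k+1,$$ where $\tilde{O}(\cdot)$ hides a factor linear in $n$.
   Context: For random variables $X,Y$ over $\{0,1\}^n$: min-entropy $\mathrm{H}_\infty(X)=-\log_2\max_x\Pr[X=x]$. $X$ and $Y$ are $(s,\epsilon)$-indistinguishable, written $X\sim_{s,\epsilon}Y$, if every boolean circuit $D$ of size at most $s$ satisfies $|\Pr[D(X)=1]-\Pr[D(Y)=1]|\le\epsilon$. HILL pseudoentropy: $\mathrm{H}^{\mathrm{HILL}}_{s,\epsilon}(X)=\max_{Y:\,Y\sim_{s,\epsilon}X}\mathrm{H}_\infty(Y)$, the maximum over random variables $Y$ over $\{0,1\}^n$.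
   Formalization: Proved for 0 < ε ≤ 1/2 (false for ε > 1/2, e.g. X uniform on 2^k points, n ≥ k+2), with Õ(2^k ε²) read as C·n·(2^k ε² + 1) for an absolute constant C; without the +1 it fails for tiny ε, when no gates are allowed. *)

(* Defs.v *)
From mathcomp Require Import all_boot all_order all_algebra.
From mathcomp Require Import classical_sets reals exp.
Set Implicit Arguments. Unset Strict Implicit. Unset Printing Implicit Defensive.
Import Order.TTheory GRing.Theory Num.Theory.
Local Open Scope ring_scope.

Inductive gate : Type :=
| GAnd of nat & nat
| GOr  of nat & nat
| GNot of nat.

(* Wires 0..n-1 are the inputs, wire n+i is the output of gate i;
   [out] designates the output wire. *)
Record circuit := Circuit { gates : seq gate; out : nat }.

Definition gate_wf (w : nat) (g : gate) : bool :=
  match g with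
  | GAnd i j | GOr i j => (i < w) && (j < w)
  | GNot i => i < w
  end%N.

Fixpoint gates_wf (w : nat) (gs : seq gate) : bool :=
  match gs with
  | [::] => true
  | g :: gs' => gate_wf w g && gates_wf w.+1 gs'
  end.

Definition circuit_wf (n : nat) (C : circuit) : bool :=
  gates_wf n (gates C) && (out C < n + size (gates C))%N.

Definition circuit_size (C : circuit) : nat := size (gates C).

Definition gate_eval (ws : seq bool) (g : gate) : bool :=
  match g with
  | GAnd i j => nth false ws i && nth false ws j
  | GOr i j => nth false ws i || nth false ws j
  | GNot i => ~~ nth false ws i
  end.

Definition run_gates (ws : seq bool) (gs : seq gate) : seq bool :=
  foldl (fun acc g => rcons acc (gate_eval acc g)) ws gs.

Definition circuit_eval (n : nat) (C : circuit) (x : n.-tuple bool) : bool :=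
  nth false (run_gates (tval x) (gates C)) (out C).

Definition is_dist (R : realType) (n : nat) (X : {ffun n.-tuple bool -> R}) : Prop :=
  (forall x, 0 <= X x) /\ \sum_x X x = 1.

Definition supp (R : realType) (n : nat) (X : {ffun n.-tuple bool -> R})
  : {set n.-tuple bool} := [set x | X x != 0].

Definition prob_accept (R : realType) (n : nat) (C : circuit)
  (X : {ffun n.-tuple bool -> R}) : R :=
  \sum_x (if circuit_eval C x then X x else 0).

Definition Hmin (R : realType) (n : nat) (X : {ffun n.-tuple bool -> R}) : R :=
  - (ln (\big[Num.max/0]_x X x) / ln 2).

Definition indist (R : realType) (n : nat) (s eps : R)
  (X Y : {ffun n.-tuple bool -> R}) : Prop :=
  forall C : circuit, circuit_wf n C -> (circuit_size C)%:R <= s ->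
    `|prob_accept C X - prob_accept C Y| <= eps.

(* HILL pseudoentropy: sup of H_oo(Y) over random variables Y over {0,1}^n
   with Y ~_{s,eps} X  (the sup is attained, as in the paper's "max"). *)
Definition HILL (R : realType) (n : nat) (s eps : R)
  (X : {ffun n.-tuple bool -> R}) : R :=
  sup (fun h : R => exists Y : {ffun n.-tuple bool -> R},
                     is_dist Y /\ indist s eps Y X /\ h = Hmin Y).

Definition push_unif (R : realType) (k n : nat) (f : k.-tuple bool -> n.-tuple bool)
  : {ffun n.-tuple bool -> R} :=
  [ffun x => #|[set u | f u == x]|%:R / (2 ^ k)%:R].

(* Main.v *)
(* Let S be the support of X and suppose that Y is within (s, eps) of X while
   every Y(x) is below 2^-(k+1). Then a := X - Y has mass more than 1/2 on S.
   If eps >= 1/4, the indicator of S is already a distinguisher. Otherwise cut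
   the cube into lexicographic intervals, each containing at most
   m ~ 1/(16 eps^2) points of S. On an interval I, Parseval yields a parity whose
   correlation with a is at least the l2-norm of a on I, which by Cauchy-Schwarz
   is at least 4 eps times the mass of a on the part of S in I. Using the best signed
   parity on each interval gives total correlation more than 2 eps, hence advantage
   more than eps, with O(n) gates for each of the O(2^k eps^2 + 1) intervals. *)
Require Import Defs.
From mathcomp Require Import all_boot all_order all_algebra.
From mathcomp Require boolp classical_sets.
From mathcomp Require Import reals exp lra zify.
Set Implicit Arguments. Unset Strict Implicit. Unset Printing Implicit Defensive.
Import Order.TTheory GRing.Theory Num.Theory.
Local Open Scope ring_scope.

Lemma size_run_gates (ws : seq bool) (gs : seq gate) :
  size (run_gates ws gs) = (size ws + size gs)%N.
Proof.
elim: gs ws => [|g gs IH] ws /=; first by rewrite addn0.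
by rewrite IH size_rcons addnS addSn.
Qed.

Lemma nth_run_gates (ws : seq bool) (gs : seq gate) (i : nat) :
  (i < size ws)%N -> nth false (run_gates ws gs) i = nth false ws i.
Proof.
elim: gs ws => [|g gs IH] ws //= lti.
by rewrite IH ?size_rcons ?(ltnW lti) ?ltnS ?nth_rcons ?lti // ltnW.
Qed.

Lemma run_gates_cat (ws : seq bool) (gs1 gs2 : seq gate) :
  run_gates ws (gs1 ++ gs2) = run_gates (run_gates ws gs1) gs2.
Proof. exact: foldl_cat. Qed.

Lemma gates_wf_cat (w : nat) (gs1 gs2 : seq gate) :
  gates_wf w (gs1 ++ gs2) = gates_wf w gs1 && gates_wf (w + size gs1) gs2.
Proof.
elim: gs1 w => [|g gs IH] w /=; first by rewrite addn0.
by rewrite IH andbA addSnnS.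
Qed.

(* Quantifying over the number [w] of wires already present lets fragments be
   concatenated without renumbering their wires. *)
Definition computable (n m : nat) (f : n.-tuple bool -> bool) : Prop :=
  forall w : nat, (n <= w)%N ->
  exists (gs : seq gate) (o : nat),
    [/\ gates_wf w gs, (size gs <= m)%N, (o < w + size gs)%N &
        forall (x : n.-tuple bool) (ws : seq bool), size ws = w ->
          (forall i, (i < n)%N -> nth false ws i = nth false x i) ->
          nth false (run_gates ws gs) o = f x].
Arguments computable {n} m f.

Lemma computable_circuit (n m : nat) (f : n.-tuple bool -> bool) :
  computable m f ->
  exists C : circuit, [/\ circuit_wf n C, (circuit_size C <= m)%N &
                          forall x, circuit_eval C x = f x].
Proof.
move=> /(_ n (leqnn n)) [gs [o [wf sz lto ev]]].
exists (Circuit gs o); split => //; first by rewrite /circuit_wf wf.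
by move=> x; apply: ev; rewrite ?size_tuple.
Qed.

Lemma eq_computable (n m m' : nat) (f g : n.-tuple bool -> bool) :
  f =1 g -> (m <= m')%N -> computable m f -> computable m' g.
Proof.
move=> fg lemm cf w /cf [gs [o [wf sz lto ev]]].
exists gs, o; split => //; first exact: leq_trans lemm.
by move=> x ws sws nws; rewrite -fg; exact: ev.
Qed.

Lemma computable_tnth (n : nat) (i : 'I_n) :
  computable 0 (fun x : n.-tuple bool => tnth x i).
Proof.
move=> w lenw; exists [::], i; split => //=.
  by rewrite addn0; apply: leq_trans lenw.
by move=> x ws _ ->; rewrite ?(tnth_nth false).
Qed.

Lemma computable_gadget (n c m1 m2 : nat) (f g : n.-tuple bool -> bool)
    (op : bool -> bool -> bool) (tl : nat -> nat -> nat -> seq gate) :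
  (forall w i j, (i < w)%N -> (j < w)%N ->
     gates_wf w (tl w i j) /\ size (tl w i j) = c.+1) ->
  (forall ws i j, (i < size ws)%N -> (j < size ws)%N ->
     nth false (run_gates ws (tl (size ws) i j)) (size ws + c)
     = op (nth false ws i) (nth false ws j)) ->
  computable m1 f -> computable m2 g ->
  computable (m1 + m2 + c.+1) (fun x => op (f x) (g x)).
Proof.
move=> tlP tlE cf cg w lenw.
have [gs1 [o1 [wf1 sz1 lto1 ev1]]] := cf w lenw.
have lenw' : (n <= w + size gs1)%N by apply: leq_trans lenw (leq_addr _ _).
have [gs2 [o2 [wf2 sz2 lto2 ev2]]] := cg _ lenw'.
set w2 := (w + size gs1 + size gs2)%N in lto2.
have lto1' : (o1 < w2)%N by apply: leq_trans lto1 (leq_addr _ _).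
have [wf3 sz3] := tlP w2 o1 o2 lto1' lto2.
exists (gs1 ++ gs2 ++ tl w2 o1 o2), (w2 + c)%N; split.
- by rewrite !gates_wf_cat wf1 wf2.
- by rewrite !size_cat sz3 addnA leq_add2r leq_add.
- by rewrite !size_cat sz3 !addnA addnS.
move=> x ws sws nws; rewrite !run_gates_cat.
set ws1 := run_gates ws gs1; set ws2 := run_gates ws1 gs2.
have sws1 : size ws1 = (w + size gs1)%N by rewrite size_run_gates sws.
have sws2 : size ws2 = w2 by rewrite size_run_gates sws1.
rewrite -sws2 tlE ?sws2 //; congr op.
  by rewrite nth_run_gates ?sws1 //; apply: ev1.
apply: ev2 => // i ltin; rewrite nth_run_gates ?nws // sws.
exact: leq_trans lenw.
Qed.

Section Connectives.
Context {n m1 m2 : nat} {f g : n.-tuple bool -> bool}.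
Context (cf : computable m1 f) (cg : computable m2 g).

Lemma computable_and : computable (m1 + m2 + 1) (fun x => f x && g x).
Proof.
apply: (@computable_gadget _ 0 _ _ _ _ andb (fun w i j => [:: GAnd i j])) => //.
  by move=> w i j /= -> ->.
by move=> ws i j li lj /=; rewrite addn0 nth_rcons ltnn eqxx.
Qed.

Lemma computable_or : computable (m1 + m2 + 1) (fun x => f x || g x).
Proof.
apply: (@computable_gadget _ 0 _ _ _ _ orb (fun w i j => [:: GOr i j])) => //.
  by move=> w i j /= -> ->.
by move=> ws i j li lj /=; rewrite addn0 nth_rcons ltnn eqxx.
Qed.

Lemma computable_andN : computable (m1 + m2 + 2) (fun x => f x && ~~ g x).
Proof.
apply: (@computable_gadget _ 1 _ _ _ _ (fun a b => a && ~~ b)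
          (fun w i j => [:: GNot j; GAnd i w])) => //.
  by move=> w i j li lj /=; rewrite lj ltnSn (leqW li).
move=> ws i j li lj /=.
by rewrite addn1 !nth_rcons !size_rcons ltnn li !ltnn !eqxx.
Qed.

Lemma computable_orN : computable (m1 + m2 + 2) (fun x => f x || ~~ g x).
Proof.
apply: (@computable_gadget _ 1 _ _ _ _ (fun a b => a || ~~ b)
          (fun w i j => [:: GNot j; GOr i w])) => //.
  by move=> w i j li lj /=; rewrite lj ltnSn (leqW li).
move=> ws i j li lj /=.
by rewrite addn1 !nth_rcons !size_rcons ltnn li !ltnn !eqxx.
Qed.

Lemma computable_xor : computable (m1 + m2 + 4) (fun x => f x (+) g x).
Proof.
apply: (@computable_gadget _ 3 _ _ _ _ addb
  (fun w i j => [:: GOr i j; GAnd i j; GNot w.+1; GAnd w w.+2])) => //.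
  move=> w i j li lj; split=> //=.
  by rewrite li lj (leqW li) (leqW lj) !ltnS leqnn !leqW.
move=> ws i j li lj /=.
rewrite addn3 !nth_rcons !size_rcons !ltnS !ltnn !eqxx !leqnn li lj.
rewrite leqnSn.
by case: (nth _ _ i); case: (nth _ _ j).
Qed.

End Connectives.

Lemma computable_if (n m1 m2 m3 : nat) (f g h : n.-tuple bool -> bool) :
  computable m1 f -> computable m2 g -> computable m3 h ->
  computable (m1.*2 + m2 + m3 + 4) (fun x => if f x then g x else h x).
Proof.
move=> cf cg ch.
apply: eq_computable (computable_or (computable_and cg cf) (computable_andN ch cf)).
  by move=> x /=; case: (f x); rewrite ?andbT ?andbF ?orbF.
by rewrite -addnn; lia.
Qed.

Lemma computable_const (n : nat) (b : bool) :
  (0 < n)%N -> computable 2 (fun _ : n.-tuple bool => b).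
Proof.
move=> n0; have c0 := computable_tnth (Ordinal n0).
case: b; [apply: eq_computable (computable_orN c0 c0) |
          apply: eq_computable (computable_andN c0 c0)] => // x.
  exact: orbN.
exact: andbN.
Qed.

Definition parity (n : nat) (r : {ffun 'I_n -> bool}) (e : bool)
    (s : seq 'I_n) (x : n.-tuple bool) : bool :=
  foldr (fun i b => if r i then tnth x i (+) b else b) e s.
Arguments parity {n} r e s x.

Lemma computable_parity (n : nat) (r : {ffun 'I_n -> bool}) (e : bool) (s : seq 'I_n) :
  (0 < n)%N -> computable (2 + 4 * size s) (parity r e s).
Proof.
move=> n0; elim: s => [|i s IH] /=; first exact: computable_const.
case ri: (r i).
  apply: eq_computable (computable_xor (computable_tnth i) IH) => [x|]; last by lia.
  by rewrite /parity /= ri.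
by apply: eq_computable IH => [x|]; [rewrite /parity /= ri | lia].
Qed.

Lemma computable_eq (n : nat) (c : n.-tuple bool) :
  (0 < n)%N -> computable (2 + 2 * n) (fun x => x == c).
Proof.
move=> n0.
have H (s : seq 'I_n) :
    computable (2 + 2 * size s) (fun x => all (fun i => tnth x i == tnth c i) s).
  elim: s => [|i s IH] /=; first exact: (computable_const true n0).
  case ci: (tnth c i).
    apply: eq_computable (computable_and (computable_tnth i) IH) => [x|]; last by lia.
    by rewrite eqb_id.
  apply: eq_computable (computable_andN IH (computable_tnth i)) => [x|]; last by lia.
  by rewrite eqbF_neg andbC.
apply: eq_computable (H (enum 'I_n)) => [x|]; last by rewrite size_enum_ord.
apply/allP/eqP => [eqxc|-> i _] //.
by apply: eq_from_tnth => i; apply/eqP/eqxc; rewrite mem_enum.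
Qed.

Lemma computable_mem (n : nat) (s : seq (n.-tuple bool)) :
  (0 < n)%N -> computable (2 + (2 * n + 3) * size s) (fun x => x \in s).
Proof.
move=> n0; elim: s => [|c s IH] /=; first by rewrite muln0; exact: (computable_const false n0).
apply: eq_computable (computable_or (computable_eq c n0) IH) => [x|]; last by nia.
by rewrite inE.
Qed.

Section LexicographicIntervals.
Context {n : nat}.
Implicit Types (x y : n.-tuple bool) (s : seq 'I_n).

Fixpoint binary x s : nat :=
  if s is i :: s' then (tnth x i * 2 ^ size s' + binary x s')%N else 0%N.

Lemma binary_lt x s : (binary x s < 2 ^ size s)%N.
Proof. by elim: s => //= i s IH; case: (tnth x i); rewrite expnS; lia. Qed.

Lemma binary_inj x y s : binary x s = binary y s -> {in s, tnth x =1 tnth y}.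
Proof.
elim: s => //= i s IH.
have := binary_lt x s; have := binary_lt y s.
case xi: (tnth x i); case yi: (tnth y i) => lty ltx e; try lia.
all: have exy : binary x s = binary y s by lia.
all: by move=> j; rewrite inE => /orP[/eqP->|/(IH exy)//]; rewrite xi yi.
Qed.

Definition lexrank x := binary x (enum 'I_n).

Lemma lexrank_inj : injective lexrank.
Proof.
move=> x y /binary_inj exy; apply: eq_from_tnth => i.
by apply: exy; rewrite mem_enum.
Qed.

Lemma computable_lexrank_ge (c : n.-tuple bool) :
  (0 < n)%N -> computable (2 + n) (fun x => (lexrank c <= lexrank x)%N).
Proof.
move=> n0.
have H s : computable (2 + size s) (fun x => (binary c s <= binary x s)%N).
  elim: s => [|i s IH] /=; first exact: (computable_const true n0).
  have ltc := binary_lt c s.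
  case ci: (tnth c i).
    apply: eq_computable (computable_and (computable_tnth i) IH) => [x|]; last by lia.
    have := binary_lt x s; case: (tnth x i) => /= ltx; last by lia.
    by rewrite leq_add2l.
  apply: eq_computable (computable_or (computable_tnth i) IH) => [x|]; last by lia.
  by have := binary_lt x s; case: (tnth x i) => /= ltx; lia.
by have := H (enum 'I_n); rewrite size_enum_ord.
Qed.

Lemma computable_upset (P : pred (n.-tuple bool)) :
  (0 < n)%N -> (forall x y, (lexrank x <= lexrank y)%N -> P x -> P y) ->
  computable (2 + n) P.
Proof.
move=> n0 upP; case: (pickP P) => [x0 Px0|P0]; last first.
  by apply: eq_computable (computable_const false n0) => [x|]; rewrite ?P0 ?leq_addr.
case: (arg_minnP lexrank Px0) => c Pc minc.
apply: eq_computable (computable_lexrank_ge c n0) => // x.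
by apply/idP/idP => [le|/minc//]; apply: upP le Pc.
Qed.

Context (S : {set n.-tuple bool}) (m : nat).

Definition rank_in x := #|[set y in S | (lexrank y < lexrank x)%N]|.

Definition bucket x := (rank_in x %/ m)%N.

Lemma rank_in_mono x y : (lexrank x <= lexrank y)%N -> (rank_in x <= rank_in y)%N.
Proof.
move=> lexy; apply/subset_leq_card/subsetP => z; rewrite !inE => /andP[-> ltz].
exact: leq_trans lexy.
Qed.

Lemma rank_in_lt x y :
  x \in S -> (lexrank x < lexrank y)%N -> (rank_in x < rank_in y)%N.
Proof.
move=> xS ltxy; apply/proper_card/properP; split.
  apply/subsetP => z; rewrite !inE => /andP[-> ltz].
  exact: ltn_trans ltxy.
by exists x; rewrite !inE xS ?ltxy // ltnn.
Qed.

Lemma rank_in_inj : {in S &, injective rank_in}.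
Proof.
move=> x y xS yS exy; apply: lexrank_inj.
case: (ltngtP (lexrank x) (lexrank y)) => // lt.
  by have := rank_in_lt xS lt; rewrite exy ltnn.
by have := rank_in_lt yS lt; rewrite exy ltnn.
Qed.

Lemma bucket_le x : (bucket x <= #|S| %/ m)%N.
Proof.
by apply/leq_div2r/subset_leq_card/subsetP => z; rewrite inE => /andP[].
Qed.

Lemma card_bucket (j : nat) :
  (0 < m)%N -> (#|[set x in S | bucket x == j]| <= m)%N.
Proof.
move=> m0; set B := [set _ in _ | _].
pose h x := Ordinal (ltn_pmod (rank_in x) m0).
rewrite -[X in (_ <= X)%N]card_ord -(card_in_imset (f := h)) ?max_card //.
move=> x y; rewrite !inE => /andP[xS /eqP bx] /andP[yS /eqP byy] [exy].
apply: rank_in_inj => //.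
by rewrite (divn_eq (rank_in x) m) (divn_eq (rank_in y) m) -!/(bucket _) bx byy exy.
Qed.

Lemma computable_bucket_ge (j : nat) :
  (0 < n)%N -> computable (2 + n) (fun x => (j <= bucket x)%N).
Proof.
move=> n0; apply: computable_upset => // x y lexy lej.
by apply: leq_trans lej (leq_div2r _ (rank_in_mono lexy)).
Qed.

End LexicographicIntervals.

Section Parseval.
Context {R : realType} {n : nat}.
Implicit Types (a : n.-tuple bool -> R) (x y : n.-tuple bool).

Definition character (r : {ffun 'I_n -> bool}) x : R :=
  \prod_i (-1) ^+ (r i && tnth x i).

Lemma sign_parity r e x :
  (-1) ^+ parity r e (enum 'I_n) x = (-1) ^+ e * character r x :> R.
Proof.
rewrite /character -big_enum /=; elim: (enum _) => [|i s IH] /=.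
  by rewrite big_nil mulr1.
rewrite big_cons mulrCA -IH /parity /=.
by case: (r i); rewrite ?signr_addb ?mul1r.
Qed.

Lemma sum_character_mul x y :
  \sum_r character r x * character r y = (2 ^ n)%:R * (x == y)%:R.
Proof.
transitivity (\sum_(r : {ffun 'I_n -> bool})
                \prod_i (-1) ^+ (r i && (tnth x i (+) tnth y i)) : R).
  apply: eq_bigr => r _; rewrite -big_split; apply: eq_bigr => i _ /=.
  by rewrite -signr_addb; case: (r i).
rewrite -(bigA_distr_bigA (fun i b => (-1) ^+ (b && (tnth x i (+) tnth y i)))) /=.
have [->|nexy] := eqVneq x y.
  under eq_bigr => i _ do rewrite big_bool addbb /=.
  by rewrite prodr_const card_ord mulr1 natrX.
have [i nei] : exists i, tnth x i != tnth y i.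
  apply/existsP; apply: contraNT nexy; rewrite negb_exists => /forallP eqxy.
  by apply/eqP/eq_from_tnth => i; apply/eqP; rewrite -[_ == _]negbK.
rewrite mulr0 (bigD1 i) //= big_bool /=.
by move: nei; case: (tnth x i); case: (tnth y i) => //= _; rewrite expr1 addNr mul0r.
Qed.

Lemma parseval a :
  \sum_r (\sum_x character r x * a x) ^+ 2 = (2 ^ n)%:R * \sum_x a x ^+ 2.
Proof.
transitivity (\sum_x \sum_y (\sum_r character r x * character r y) * (a x * a y)).
  under eq_bigr do rewrite expr2 big_distrlr.
  rewrite exchange_big /=; apply: eq_bigr => x _.
  rewrite exchange_big /=; apply: eq_bigr => y _.
  by rewrite mulr_suml; apply: eq_bigr => r _; rewrite mulrACA.
rewrite mulr_sumr; apply: eq_bigr => x _.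
rewrite (bigD1 x) //= sum_character_mul big1 => [|y nyx]; last first.
  by rewrite sum_character_mul eq_sym (negbTE nyx) mulr0 mul0r.
by rewrite addr0 eqxx mulr1 expr2.
Qed.

(* The maximum of the squared Fourier coefficients is at least their mean. *)
Lemma exists_parity_correlated a :
  exists r e, let Z := \sum_x (-1) ^+ parity r e (enum 'I_n) x * a x in
    0 <= Z /\ \sum_x a x ^+ 2 <= Z ^+ 2.
Proof.
pose Q := \sum_x a x ^+ 2.
pose Z r := \sum_x character r x * a x.
have [r leQ] : exists r, Q <= Z r ^+ 2.
  apply/existsP; apply: contraT; rewrite negb_exists => /forallP ltQ.
  have : \sum_r Z r ^+ 2 < \sum_(r : {ffun 'I_n -> bool}) Q.
    apply: ltr_sum => [|r _]; last by rewrite ltNge.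
    by apply/hasP; exists [ffun => false]; rewrite ?mem_index_enum.
  rewrite parseval sumr_const card_ffun card_bool card_ord.
  by rewrite mulr_natl ltxx.
exists r, (Z r < 0).
have -> : \sum_x (-1) ^+ parity r (Z r < 0) (enum 'I_n) x * a x = `|Z r|.
  rewrite normrEsign mulr_sumr.
  by apply: eq_bigr => x _; rewrite sign_parity mulrA.
by rewrite /= normr_ge0 real_normK ?num_real.
Qed.

End Parseval.

Lemma sqr_sum_le (R : realType) (T : finType) (A : {set T}) (a : T -> R) :
  (\sum_(x in A) a x) ^+ 2 <= #|A|%:R * \sum_(x in A) a x ^+ 2.
Proof.
have [->|/set0Pn A0] := eqVneq A set0; first by rewrite !big_set0 mulr0 expr2 mul0r.
have cA : 0 < #|A|%:R :> R by rewrite ltr0n; apply/card_gt0P.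
set s := \sum_(x in A) a x; set Q := \sum_(x in A) _; set c := #|A|%:R in cA *.
have : 0 <= \sum_(x in A) (c * a x - s) ^+ 2 by apply: sumr_ge0 => x _; exact: sqr_ge0.
have -> : \sum_(x in A) (c * a x - s) ^+ 2 = c * (c * Q - s ^+ 2).
  transitivity (\sum_(x in A) (c ^+ 2 * a x ^+ 2 - 2 * c * s * a x + s ^+ 2)).
    by apply: eq_bigr => x _; lra.
  rewrite big_split /= sumrB -!mulr_sumr sumr_const -/s -/Q -mulr_natl -/c; lra.
by rewrite pmulr_rge0 // subr_ge0.
Qed.

Section Distinguisher.
Context {R : realType} {n : nat} (S : {set n.-tuple bool}) (a : n.-tuple bool -> R).
Context (c : R) (m : nat).
Context (n0 : (0 < n)%N) (m0 : (0 < m)%N) (c0 : 0 <= c) (mc : m%:R * c ^+ 2 <= 1).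

Lemma bucket_distinguisher (j : nat) :
  exists2 d, computable (2 + 4 * n) d &
    c * \sum_(x in S | bucket S m x == j) a x
    <= \sum_(x | bucket S m x == j) (-1) ^+ (d x) * a x.
Proof.
pose b x := if bucket S m x == j then a x else 0.
have [r [e [Z0 leZ]]] := exists_parity_correlated b.
exists (parity r e (enum 'I_n)).
  by have := computable_parity r e (enum 'I_n) n0; rewrite size_enum_ord.
set Z := \sum_x _ in Z0 leZ.
have -> : \sum_(x | bucket S m x == j) (-1) ^+ parity r e (enum 'I_n) x * a x = Z.
  by rewrite big_mkcond; apply: eq_bigr => x _; rewrite /b; case: ifP; rewrite ?mulr0.
pose B := [set x in S | bucket S m x == j].
have -> : \sum_(x in S | bucket S m x == j) a x = \sum_(x in B) a x.
  by apply: eq_bigl => x; rewrite inE.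
have leB : \sum_(x in B) a x ^+ 2 <= \sum_x b x ^+ 2.
  rewrite big_mkcond; apply: ler_sum => x _; rewrite inE /b.
  by case: (x \in S); case: (bucket S m x == j) => /=; rewrite ?expr0n ?sqr_ge0.
have Q0 : 0 <= \sum_(x in B) a x ^+ 2 by apply: sumr_ge0 => x _; exact: sqr_ge0.
have [s0|s0] := leP (\sum_(x in B) a x) 0.
  by apply: le_trans Z0; rewrite mulr_ge0_le0.
rewrite -(ler_pXn2r (n := 2)) // ?nnegrE ?mulr_ge0 // ?(ltW s0) //.
apply: le_trans leZ; apply: le_trans leB; rewrite exprMn.
have leC := sqr_sum_le B a.
have cardB : #|B|%:R <= m%:R :> R by rewrite ler_nat; apply: card_bucket.
apply: le_trans (_ : c ^+ 2 * (m%:R * \sum_(x in B) a x ^+ 2) <= _).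
  apply: ler_wpM2l; first exact: sqr_ge0.
  by apply: le_trans leC _; apply: ler_wpM2r.
by rewrite mulrA [c ^+ 2 * _]mulrC ler_piMl.
Qed.

Lemma initial_buckets_distinguisher (J : nat) :
  exists2 D, computable (2 + J * (16 * n)) D &
    c * \sum_(x in S | (bucket S m x < J)%N) a x
    <= \sum_(x | (bucket S m x < J)%N) (-1) ^+ (D x) * a x.
Proof.
elim: J => [|J [D cD leD]].
  exists (fun=> false); first exact: (computable_const false n0).
  by rewrite !big_pred0 ?mulr0 // => x; rewrite ltn0 ?andbF.
have [d cd led] := bucket_distinguisher J.
exists (fun x => if (J <= bucket S m x)%N then d x else D x).
  apply: eq_computable (computable_if (computable_bucket_ge S m J n0) cd cD) => //.
  by rewrite -addnn; nia.
rewrite (bigID (fun x => (bucket S m x < J)%N)) mulrDr.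
rewrite [leRHS](bigID (fun x => (bucket S m x < J)%N)) /=.
apply: lerD.
  apply: etrans leD; congr (_ * _ <= _); first by apply: eq_bigl => x; lia.
  apply: eq_big => [x|x /andP[_ lt]]; first by lia.
  by rewrite leqNgt lt.
apply: etrans led; congr (_ * _ <= _); first by apply: eq_bigl => x; lia.
apply: eq_big => [x|x /andP[_ ge]]; first by lia.
by rewrite leqNgt ge.
Qed.

Lemma interval_distinguisher :
  exists2 D, computable (2 + (#|S| %/ m).+1 * (16 * n)) D &
    c * \sum_(x in S) a x <= \sum_x (-1) ^+ (D x) * a x.
Proof.
have [D cD leD] := initial_buckets_distinguisher (#|S| %/ m).+1.
exists D => //; move: leD; under eq_bigl do rewrite ltnS bucket_le andbT.
by under [leRHS]eq_bigl do rewrite ltnS bucket_le.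
Qed.

End Distinguisher.

Section LightDistribution.
Context {R : realType} {n : nat}.
Implicit Types X Y : {ffun n.-tuple bool -> R}.

Lemma sum_supp X : is_dist X -> \sum_(x in supp X) X x = 1.
Proof.
move=> [_ <-]; rewrite big_mkcond; apply: eq_bigr => x _.
by rewrite inE; case: eqP => // ->.
Qed.

Lemma supp_gap X Y (k : nat) : is_dist X -> (#|supp X| <= 2 ^ k)%N ->
  (forall x, Y x < (2 ^ k.+1)%:R^-1) ->
  2^-1 < \sum_(x in supp X) (X x - Y x).
Proof.
move=> dX cX ltY; rewrite sumrB sum_supp //.
have [x xS] : exists x, x \in supp X.
  apply/set0Pn; apply: contra_eq_neq (sum_supp dX) => ->.
  by rewrite big_set0 eq_sym oner_eq0.
have : \sum_(x in supp X) Y x < \sum_(x in supp X) (2 ^ k.+1)%:R^-1.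
  by apply: ltr_sum => //; apply/hasP; exists x; rewrite ?mem_index_enum.
rewrite sumr_const -mulr_natl => lt.
have p0 : 0 < (2 ^ k)%:R :> R by rewrite ltr0n expn_gt0.
have : #|supp X|%:R * (2 ^ k.+1)%:R^-1 <= 2^-1 :> R.
  rewrite expnS natrM invfM mulrCA ler_piMr ?invr_ge0 ?ler0n //.
  by rewrite ler_pdivrMr // mul1r ler_nat.
lra.
Qed.

Lemma prob_acceptB (C : circuit) X Y :
  prob_accept C X - prob_accept C Y
  = \sum_x (if circuit_eval C x then X x - Y x else 0).
Proof. by rewrite -sumrB; apply: eq_bigr => x _; case: ifP; rewrite ?subrr. Qed.

Lemma light_distinguisher X Y (k : nat) (eps : R) :
  (0 < n)%N -> 0 < eps -> eps <= 2^-1 ->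
  is_dist X -> is_dist Y -> (#|supp X| <= 2 ^ k)%N ->
  (forall x, Y x < (2 ^ k.+1)%:R^-1) ->
  ~ indist ((512 * n)%:R * ((2 ^ k)%:R * eps ^+ 2 + 1)) eps Y X.
Proof.
move=> n0 e0 e2 dX dY cX ltY ind.
have gap := supp_gap dX cX ltY.
set S := supp X in cX gap; set s := (512 * n)%:R * _ in ind.
have cX' : #|S|%:R <= (2 ^ k)%:R :> R by rewrite ler_nat.
have n1 : 1 <= n%:R :> R by rewrite ler1n.
have adv D t : computable t D -> t%:R <= s ->
    `|\sum_x (if D x then X x - Y x else 0)| <= eps.
  move=> /computable_circuit [C [wf sz ev]] les.
  have : `|prob_accept C Y - prob_accept C X| <= eps.
    by apply: ind => //; apply: le_trans les; rewrite ler_nat.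
  by rewrite distrC prob_acceptB; under eq_bigr do rewrite ev.
have [e4|e4] := leP (4^-1) eps.
  have := adv _ _ (computable_mem (enum S) n0) _; rewrite -cardE.
  have -> : \sum_x (if x \in enum S then X x - Y x else 0)
            = \sum_(x in S) (X x - Y x).
    by rewrite [RHS]big_mkcond; apply: eq_bigr => x _; rewrite mem_enum.
  move=> H; have {}H : `|\sum_(x in S) (X x - Y x)| <= eps.
    apply: H; rewrite /s.
    have le16 : (2 ^ k)%:R <= 16 * ((2 ^ k)%:R * eps ^+ 2) :> R.
      rewrite mulrCA ler_peMr ?ler0n //; nra.
    have : (2 + (2 * n + 3) * #|S|)%:R <= n%:R * (5 * #|S|%:R + 2) :> R.
      rewrite -[5]/(5%:R) -[2 in leRHS]/(2%:R) -natrM -natrD -natrM ler_nat; nia.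
    move/le_trans; apply; rewrite natrM -mulrA mulrCA ler_wpM2l ?ler0n //.
    have : 0 <= (2 ^ k)%:R :> R by rewrite ler0n.
    lra.
  by have := ler_norm (\sum_(x in S) (X x - Y x)); lra.
pose t := (16 * eps ^+ 2)^-1.
have t1 : 1 <= t by rewrite /t invf_ge1 ?mulr_gt0 ?exprn_gt0 //; nra.
pose m := Num.truncn t.
have /andP[lem ltm] : m%:R <= t < m.+1%:R by apply: Num.Theory.truncn_itv; lra.
have m0 : (0 < m)%N by rewrite Num.Theory.truncn_gt0.
have m1 : 1 <= m%:R :> R by rewrite ler1n.
have te : t * (16 * eps ^+ 2) = 1 by rewrite mulVf // mulf_neq0 ?expf_neq0 ?gt_eqF.
have ee : 0 < eps ^+ 2 by rewrite exprn_gt0.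
have mc : m%:R * (4 * eps) ^+ 2 <= 1.
  have -> : (4 * eps) ^+ 2 = 16 * eps ^+ 2 by lra.
  by rewrite -[leRHS]te ler_wpM2r // mulr_ge0 // ltW.
have c0 : 0 <= 4 * eps by lra.
have [D cD] := @interval_distinguisher R n S (fun x => X x - Y x) (4 * eps) m n0 m0 c0 mc.
set q := (#|S| %/ m)%N in cD.
have leq : q%:R <= 32 * ((2 ^ k)%:R * eps ^+ 2) :> R.
  have : q%:R * m%:R <= (2 ^ k)%:R :> R.
    by rewrite -natrM ler_nat; apply: leq_trans cX; exact: leq_trunc_div.
  have q0 : 0 <= q%:R :> R by rewrite ler0n.
  have : 1 <= m%:R * (32 * eps ^+ 2).
    rewrite -[leLHS]te; rewrite -natr1 in ltm; nra.
  nra.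
have := adv D _ cD _.
have -> : \sum_x (if D x then X x - Y x else 0)
          = - (2^-1 * \sum_x (-1) ^+ D x * (X x - Y x)).
  have d0 : \sum_x (X x - Y x) = 0 by rewrite sumrB dX.2 dY.2 subrr.
  transitivity (\sum_x (2^-1 * (X x - Y x) - 2^-1 * ((-1) ^+ D x * (X x - Y x)))).
    by apply: eq_bigr => x _; case: (D x) => /=; rewrite ?expr1 ?expr0; lra.
  by rewrite sumrB -!mulr_sumr d0 mulr0 sub0r.
rewrite normrN => H leD.
have {}H : `|2^-1 * \sum_x (-1) ^+ D x * (X x - Y x)| <= eps.
  apply: H; rewrite /s.
  have : (2 + q.+1 * (16 * n))%:R <= n%:R * (16 * q%:R + 18) :> R.
    rewrite natrD !natrM -natr1; lra.
  move/le_trans; apply; rewrite natrM -mulrA mulrCA ler_wpM2l ?ler0n //.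
  have : 0 <= (2 ^ k)%:R * eps ^+ 2 by rewrite mulr_ge0 ?ler0n // ltW.
  lra.
have := ler_norm (2^-1 * \sum_x (-1) ^+ D x * (X x - Y x)).
have : 4 * eps * 2^-1 < 4 * eps * \sum_(x in S) (X x - Y x) by rewrite ltr_pM2l //; lra.
lra.
Qed.

Lemma Hmin_gt Y (k : nat) :
  is_dist Y -> k%:R + 1 < Hmin Y -> forall x, Y x < (2 ^ k.+1)%:R^-1.
Proof.
move=> [Y0 Y1] ltH x.
have leM y : Y y <= \big[Num.max/0]_z Y z by apply: le_bigmax.
apply: le_lt_trans (leM x) _; move: ltH leM; rewrite /Hmin.
set M := \big[_/_]_z _ => ltH leM.
have M0 : 0 < M.
  rewrite ltNge; apply/negP => M0.
  have : \sum_y Y y <= 0 by apply: sumr_le0 => y _; apply: le_trans (leM y) M0.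
  by rewrite Y1 ler10.
have p0 : 0 < (2 ^ k.+1)%:R^-1 :> R by rewrite invr_gt0 ltr0n expn_gt0.
have l2 : 0 < ln 2 :> R by rewrite ln_gt0 // ltr1n.
rewrite -ltr_ln ?posrE // lnV ?posrE ?ltr0n ?expn_gt0 //.
rewrite natrX lnXn // -[_ *+ k.+1]mulr_natl -[k.+1%:R]natr1.
have : (k%:R + 1) * ln 2 < - (ln M / ln 2) * ln 2 by rewrite ltr_pM2r.
rewrite mulNr divfK ?gt_eqF //; lra.
Qed.

Lemma HILL_supp X (k : nat) (eps : R) :
  0 < eps -> eps <= 2^-1 -> is_dist X -> (#|supp X| <= 2 ^ k)%N ->
  HILL ((512 * n)%:R * ((2 ^ k)%:R * eps ^+ 2 + 1)) eps X <= k%:R + 1.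
Proof.
move=> e0 e2 dX cX; rewrite /HILL; set E := (E in sup E).
have [E0|E0] := boolp.pselect (classical_sets.nonempty E); last first.
  by rewrite sup_out ?addr_ge0 ?ler0n // => -[].
apply: ge_sup => // h [Y [dY [ind ->]]].
rewrite leNgt; apply/negP => /(Hmin_gt dY) ltY.
have [n0|n0] := posnP n; last exact: light_distinguisher ind.
have [_ Y1] := dY.
have : \sum_x Y x < 1.
  apply: lt_le_trans (_ : \sum_(x : n.-tuple bool) (2 ^ k.+1)%:R^-1 <= _).
    apply: ltr_sum => //; apply/hasP.
    by exists [tuple of nseq n false]; rewrite ?mem_index_enum.
  rewrite sumr_const card_tuple card_bool {1}n0 mulr1n invf_le1 ?ltr0n ?expn_gt0 //.
  by rewrite ler1n expn_gt0.
by rewrite Y1 ltxx.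
Qed.

End LightDistribution.

Lemma is_dist_push_unif (R : realType) (k n : nat) (f : k.-tuple bool -> n.-tuple bool) :
  is_dist (push_unif R f).
Proof.
split=> [x|]; first by rewrite ffunE divr_ge0 // ler0n.
under eq_bigr do rewrite ffunE.
rewrite -mulr_suml -natr_sum.
have -> : (\sum_x #|[set u | f u == x]|)%N = (2 ^ k)%N.
  have -> : (2 ^ k)%N = #|{: k.-tuple bool}| by rewrite card_tuple card_bool.
  rewrite -sum1_card (partition_big f predT) //=.
  by apply: eq_bigr => x _; rewrite sum1dep_card.
by rewrite divff // pnatr_eq0 -lt0n expn_gt0.
Qed.

Lemma card_supp_push_unif (R : realType) (k n : nat)
    (f : k.-tuple bool -> n.-tuple bool) :
  (#|supp (push_unif R f)| <= 2 ^ k)%N.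
Proof.
have -> : (2 ^ k)%N = #|{: k.-tuple bool}| by rewrite card_tuple card_bool.
rewrite -cardsT; apply: leq_trans (leq_imset_card f setT).
apply/subset_leq_card/subsetP => x; rewrite inE ffunE mulf_eq0 negb_or => /andP[].
rewrite pnatr_eq0 -lt0n => /card_gt0P [u]; rewrite inE => /eqP <- _.
exact: imset_f.
Qed.

(* Õ(2^k eps^2) with a factor linear in n hidden:  s = C * n * (2^k * eps^2 + 1)
   for an absolute constant C (see NOTES.md). *)
Theorem theorem1 :
  exists C : nat, forall (R : realType) (n k : nat) (eps : R),
    0 < eps -> eps <= 2^-1 ->
    let s : R := (C * n)%:R * ((2 ^ k)%:R * eps ^+ 2 + 1) in
    (forall f : k.-tuple bool -> n.-tuple bool,
        HILL s eps (push_unif R f) <= k%:R + 1) /\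
    (forall X : {ffun n.-tuple bool -> R}, is_dist X ->
        (#|supp X| <= 2 ^ k)%N ->
        HILL s eps X <= k%:R + 1).
Proof.
exists 512%N => R n k eps e0 e2 s; split=> [f|X dX cX]; last exact: HILL_supp.
by apply: HILL_supp => //; [exact: is_dist_push_unif | exact: card_supp_push_unif].
Qed.
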